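(* If a sequent in the language with iterative divisions is true in all non-standard square R-models (for that language), then it is derivable (without hypotheses) in $\mathbf{L}^{\Lambda}\wedge\mathbf{0}\mathbf{1}\mathrm{ItD}$.
   Context: Formulae are built from a countable set of propositional variables and the constants $\mathbf{0}$, $\mathbf{1}$ using the binary connectives $\cdot$, $\backslash$, $/$, $\wedge$ and two further binary connectives (iterative divisions) written $A^*\backslash B$ and $B/A^*$. A sequent is $\Pi \to B$ with $B$ a formula and $\Pi$ a finite, possibly empty, sequence of formulae (empty sequence written $\Lambda$); $A^n$ in an antecedent denotes $n$ consecutive copies of $A$. The calculus $\mathbf{L}^{\Lambda}\wedge\mathbf{0}\mathbf{1}\mathrm{ItD}$ has the axioms $A \to A$, $\Gamma,\mathbf{0},\Delta \to C$ and $\Lambda \to \mathbf{1}$, and rules (capital Greek letters denote possibly empty sequences): (Cut) from $\Pi \to A$ and $\Gamma, A, \Delta \to C$ infer $\Gamma,\Pi,\Delta\to C$; ($\backslash L$) from $\Pi\to A$ and $\Gamma,B,\Delta\to C$ infer $\Gamma,\Pi,A\backslash B,\Delta\to C$; ($\backslash R$) from $A,\Pi\to B$ infer $\Pi\to A\backslash B$; ($/ L$) from $\Pi\to A$ and $\Gamma,B,\Delta\to C$ infer $\Gamma,B/A,\Pi,\Delta\to C$; ($/R$) from $\Pi,A\to B$ infer $\Pi\to B/A$; ($\cdot L$) from $\Gamma,A,B,\Delta\to C$ infer $\Gamma,A\cdot B,\Delta\to C$; ($\cdot R$) from $\Pi\to A$ and $\Delta\to B$ infer $\Pi,\Delta\to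 A\cdot B$; ($\wedge L$) from $\Gamma,A,\Delta\to C$ infer both $\Gamma,A\wedge B,\Delta\to C$ and $\Gamma,B\wedge A,\Delta\to C$; ($\wedge R$) from $\Pi\to A$ and $\Pi\to B$ infer $\Pi\to A\wedge B$; ($\mathbf{1} L$) from $\Gamma,\Delta\to C$ infer $\Gamma,\mathbf{1},\Delta\to C$; ($*\backslash L$), for each $n\ge0$: from $\Pi_1\to A,\ldots,\Pi_n\to A$ and $\Gamma,B,\Delta\to C$ infer $\Gamma,\Pi_1,\ldots,\Pi_n,A^*\backslash B,\Delta\to C$; ($*\backslash R$) (an $\omega$-rule) from the infinitely many premises $A^n,\Pi\to B$ for all $n\ge0$ infer $\Pi\to A^*\backslash B$; ($/* L$), for each $n\ge 0$: from $\Pi_1\to A,\ldots,\Pi_n\to A$ and $\Gamma,B,\Delta\to C$ infer $\Gamma,B/A^*,\Pi_1,\ldots,\Pi_n,\Delta\to C$; ($/* R$) from the premises $\Pi,A^n\to B$ for all $n\ge0$ infer $\Pi\to B/A^*$. Derivations are well-founded (possibly infinitely branching) trees. For binary relations $R,S$ on a non-empty set $W$: $R\circ S=\{(x,z) \mid \exists y\,((x,y)\in R, (y,z)\in S)\}$; $R\backslash S=\{(y,z)\in W\times W \mid \forall x\,((x,y)\in R\Rightarrow (x,z)\in S)\}$; $S/R=\{(x,y)\in W\times W \mid \forall z\,((y,z)\in R\Rightarrow(x,z)\in S)\}$; $\delta=\{(x,x)\mid x\in W\}$; $R^*=\delta\cup R\cup(R\circ R)\cup(R\circ R\circ R)\cup\cdots$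 (reflexive-transitive closure). A non-standard square R-model for this language is a tuple $(W,\mathfrak{A},\mathbf{1}_{\mathfrak{A}},\mathbf{0}_{\mathfrak{A}},v)$ where $W$ is non-empty; $\mathfrak{A}$ is a family of binary relations on $W$ closed under $\circ,\backslash,/,\cap$; $\mathbf{1}_{\mathfrak{A}}\in\mathfrak{A}$ with $\mathbf{1}_{\mathfrak{A}}\circ R=R\circ\mathbf{1}_{\mathfrak{A}}=R$ for all $R\in\mathfrak{A}$; $\mathbf{0}_{\mathfrak{A}}\in\mathfrak{A}$ with $\mathbf{0}_{\mathfrak{A}}\subseteq R$ for all $R\in\mathfrak{A}$; and $v$ maps every formula to a member of $\mathfrak{A}$ with $v(A\cdot B)=v(A)\circ v(B)$, $v(A\backslash B)=v(A)\backslash v(B)$, $v(B/A)=v(B)/v(A)$, $v(A\wedge B)=v(A)\cap v(B)$, $v(\mathbf{1})=\mathbf{1}_{\mathfrak{A}}$, $v(\mathbf{0})=\mathbf{0}_{\mathfrak{A}}$, $v(A^*\backslash B)=(v(A))^*\backslash v(B)$, $v(B/A^* )=v(B)/(v(A))^*$. A sequent $A_1,\ldots,A_n\to B$ ($n\ge1$) is true in the model if $v(A_1)\circ\cdots\circ v(A_n)\subseteq v(B)$, and $\Lambda\to B$ is true if $\delta\subseteq v(B)$. *)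

(* Defs.v *)
From mathcomp Require Import all_boot.
From mathcomp Require Import boolp classical_sets.

Set Implicit Arguments.
Unset Strict Implicit.
Unset Printing Implicit Defensive.

Local Open Scope classical_set_scope.

(* Arguments are in the order in which they are written: [Ldiv A B] is A \ B,
   [Rdiv B A] is B / A, [ItLdiv A B] is A^* \ B and [ItRdiv B A] is B / A^*. *)
Inductive formula : Type :=
| Var of nat
| Zero
| One
| Mul of formula & formula
| Ldiv of formula & formula
| Rdiv of formula & formula
| And of formula & formula
| ItLdiv of formula & formula
| ItRdiv of formula & formula.

(* [derivable Pi B] : the sequent Pi -> B has a derivation without hypotheses.
   In the left rules for iterative divisions n is [size Pis], and the list
   [Pis] consists of Pi_1, ..., Pi_n. *)
Inductive derivable : seq formula -> formula -> Prop :=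
| d_ax A : derivable [:: A] A
| d_zeroL G D C : derivable (G ++ Zero :: D) C
| d_oneR : derivable [::] One
| d_cut Pi A G D C :
    derivable Pi A -> derivable (G ++ A :: D) C ->
    derivable (G ++ Pi ++ D) C
| d_ldivL Pi A B G D C :
    derivable Pi A -> derivable (G ++ B :: D) C ->
    derivable (G ++ Pi ++ Ldiv A B :: D) C
| d_ldivR Pi A B :
    derivable (A :: Pi) B -> derivable Pi (Ldiv A B)
| d_rdivL Pi A B G D C :
    derivable Pi A -> derivable (G ++ B :: D) C ->
    derivable (G ++ Rdiv B A :: Pi ++ D) C
| d_rdivR Pi A B :
    derivable (Pi ++ [:: A]) B -> derivable Pi (Rdiv B A)
| d_mulL A B G D C :
    derivable (G ++ A :: B :: D) C -> derivable (G ++ Mul A B :: D) C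
| d_mulR Pi D A B :
    derivable Pi A -> derivable D B -> derivable (Pi ++ D) (Mul A B)
| d_andL1 A B G D C :
    derivable (G ++ A :: D) C -> derivable (G ++ And A B :: D) C
| d_andL2 A B G D C :
    derivable (G ++ A :: D) C -> derivable (G ++ And B A :: D) C
| d_andR Pi A B :
    derivable Pi A -> derivable Pi B -> derivable Pi (And A B)
| d_oneL G D C :
    derivable (G ++ D) C -> derivable (G ++ One :: D) C
| d_itldivL (Pis : seq (seq formula)) A B G D C :
    (forall i, i < size Pis -> derivable (nth [::] Pis i) A) ->
    derivable (G ++ B :: D) C ->
    derivable (G ++ flatten Pis ++ ItLdiv A B :: D) C
| d_itldivR Pi A B :
    (forall n, derivable (nseq n A ++ Pi) B) -> derivable Pi (ItLdiv A B)
| d_itrdivL (Pis : seq (seq formula)) A B G D C :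
    (forall i, i < size Pis -> derivable (nth [::] Pis i) A) ->
    derivable (G ++ B :: D) C ->
    derivable (G ++ ItRdiv B A :: flatten Pis ++ D) C
| d_itrdivR Pi A B :
    (forall n, derivable (Pi ++ nseq n A) B) -> derivable Pi (ItRdiv B A).

(* Diagrammatic order; the library's [R \; S] composes the other way round. *)
Definition rcomp (W : Type) (R S : set (W * W)) : set (W * W) :=
  [set xz | exists2 y, R (xz.1, y) & S (y, xz.2)].

Definition rldiv (W : Type) (R S : set (W * W)) : set (W * W) :=
  [set yz | forall x, R (x, yz.1) -> S (x, yz.2)].

Definition rrdiv (W : Type) (S R : set (W * W)) : set (W * W) :=
  [set xy | forall z, R (xy.2, z) -> S (xy.1, z)].

Fixpoint rpow (W : Type) (R : set (W * W)) (n : nat) : set (W * W) :=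
  if n is m.+1 then rcomp R (rpow R m) else diagonal.

Definition rstar (W : Type) (R : set (W * W)) : set (W * W) :=
  \bigcup_n rpow R n.

(* Only the value of v on formulae is required to lie in the family: the family
   need not be closed under R, S |-> R^* \ S and S / R^*, and the unit [ns_one]
   need not be the diagonal. *)
Record ns_square_model : Type := NSSquareModel {
  ns_W : Type;
  ns_fam : set (set (ns_W * ns_W));
  ns_one : set (ns_W * ns_W);
  ns_zero : set (ns_W * ns_W);
  ns_v : formula -> set (ns_W * ns_W);
  ns_W_nonempty : inhabited ns_W;
  ns_fam_comp R S : ns_fam R -> ns_fam S -> ns_fam (rcomp R S);
  ns_fam_ldiv R S : ns_fam R -> ns_fam S -> ns_fam (rldiv R S);
  ns_fam_rdiv S R : ns_fam S -> ns_fam R -> ns_fam (rrdiv S R);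
  ns_fam_cap R S : ns_fam R -> ns_fam S -> ns_fam (R `&` S);
  ns_fam_one : ns_fam ns_one;
  ns_onel R : ns_fam R -> rcomp ns_one R = R;
  ns_oner R : ns_fam R -> rcomp R ns_one = R;
  ns_fam_zero : ns_fam ns_zero;
  ns_zero_min R : ns_fam R -> ns_zero `<=` R;
  ns_fam_v A : ns_fam (ns_v A);
  ns_v_mul A B : ns_v (Mul A B) = rcomp (ns_v A) (ns_v B);
  ns_v_ldiv A B : ns_v (Ldiv A B) = rldiv (ns_v A) (ns_v B);
  ns_v_rdiv B A : ns_v (Rdiv B A) = rrdiv (ns_v B) (ns_v A);
  ns_v_and A B : ns_v (And A B) = ns_v A `&` ns_v B;
  ns_v_one : ns_v One = ns_one;
  ns_v_zero : ns_v Zero = ns_zero;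
  ns_v_itldiv A B : ns_v (ItLdiv A B) = rldiv (rstar (ns_v A)) (ns_v B);
  ns_v_itrdiv B A : ns_v (ItRdiv B A) = rrdiv (ns_v B) (rstar (ns_v A))
}.

Arguments ns_fam : clear implicits.
Arguments ns_one : clear implicits.
Arguments ns_zero : clear implicits.
Arguments ns_v : clear implicits.

Definition sequent_true (M : ns_square_model) (Pi : seq formula) (B : formula)
    : Prop :=
  if Pi is A :: Pi' then
    foldl (fun R C => rcomp R (ns_v M C)) (ns_v M A) Pi' `<=` ns_v M B
  else diagonal `<=` ns_v M B.

(* Main.v *)
Require Import Defs.
From HB Require Import structures.
From mathcomp Require Import all_boot.
From mathcomp Require Import boolp classical_sets.

(** One model, on the set of natural numbers, refutes all underivable sequents.
    Some ordered pairs of points carry a formula as a label, and [v A] is the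
    set of pairs whose label [C] satisfies [C -> A]. The points are added one
    at a time; each new point [n] is a witness for one instance of
    [v (A \ B) = v A \ v B], [v (B / A) = v B / v A] or
    [v (A . B) = v A o v B]. The labelled pairs always form a partial order
    with [One] on the diagonal, and the label of [(u, w)] implies the product
    of the labels of [(u, v)] and [(v, w)].

    An off-diagonal pair labelled below [A . B] is split by inserting a new
    point. At a diagonal pair this would create a cycle; but if
    [Lambda -> A . B] is derivable, then so are [Lambda -> A] and
    [Lambda -> B], and the point is its own witness. This property of
    derivations without hypotheses follows from a variant of Kleene's slash,
    so cut elimination is not needed. The omega-rules enter only through
    [v (A^* \ B)] being the intersection of all [v (A \ ... \ (A \ B))]. *)

Set Implicit Arguments.
Unset Strict Implicit.
Unset Printing Implicit Defensive.

Local Open Scope classical_set_scope.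

(** * Derivability as a preorder *)

Definition fle (A B : formula) : Prop := derivable [:: A] B.

Lemma fle_refl A : fle A A.
Proof. exact: d_ax. Qed.

Lemma derivable_fle Pi A B : derivable Pi A -> fle A B -> derivable Pi B.
Proof. by move=> dA dB; have := @d_cut Pi A [::] [::] B dA dB; rewrite /= cats0. Qed.

Lemma fle_trans B A C : fle A B -> fle B C -> fle A C.
Proof. exact: derivable_fle. Qed.

(** Cutting with the sequent A, B -> A . B inverts the left product rule. *)
Lemma derivable_mul A B Pi C : derivable (A :: B :: Pi) C <-> derivable (Mul A B :: Pi) C.
Proof.
split; first exact: (@d_mulL A B [::] Pi C).
apply: (@d_cut [:: A; B] (Mul A B) [::] Pi C).
by apply: (@d_mulR [:: A] [:: B]); apply: d_ax.
Qed.

Lemma fle_mul A A' B B' : fle A A' -> fle B B' -> fle (Mul A B) (Mul A' B').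
Proof. by move=> lA lB; apply/derivable_mul; apply: (@d_mulR [:: A] [:: B]). Qed.

Lemma fle_mulA A B C : fle (Mul A (Mul B C)) (Mul (Mul A B) C).
Proof.
apply/derivable_mul; apply: (@d_mulL B C [:: A] [::]).
apply: (@d_mulR [:: A; B] [:: C]); last exact: d_ax.
by apply: (@d_mulR [:: A] [:: B]); apply: d_ax.
Qed.

Lemma fle_mulAV A B C : fle (Mul (Mul A B) C) (Mul A (Mul B C)).
Proof.
do 2 apply: (proj1 (derivable_mul _ _ _ _)).
apply: (@d_mulR [:: A] [:: B; C]); first exact: d_ax.
by apply: (@d_mulR [:: B] [:: C]); apply: d_ax.
Qed.

Lemma fle_mul1l A : fle (Mul One A) A.
Proof. by apply/derivable_mul; apply: (@d_oneL [::]); apply: d_ax. Qed.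

Lemma fle_mul1r A : fle (Mul A One) A.
Proof. by apply/derivable_mul; apply: (@d_oneL [:: A]); apply: d_ax. Qed.

Lemma fle_1mull A : fle A (Mul One A).
Proof. by apply: (@d_mulR [::] [:: A]); [apply: d_oneR|apply: d_ax]. Qed.

Lemma fle_1mulr A : fle A (Mul A One).
Proof. by apply: (@d_mulR [:: A] [::]); [apply: d_ax|apply: d_oneR]. Qed.

Lemma derivable_ldiv Pi A B : derivable Pi (Ldiv A B) <-> derivable (A :: Pi) B.
Proof.
split=> [d|]; last exact: d_ldivR.
have := @d_cut Pi (Ldiv A B) [:: A] [::] B d; rewrite /= cats0; apply.
by apply: (@d_ldivL [:: A] A B [::] [::]); apply: d_ax.
Qed.

Lemma derivable_rdiv Pi A B : derivable Pi (Rdiv B A) <-> derivable (Pi ++ [:: A]) B.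
Proof.
split=> [d|]; last exact: d_rdivR.
apply: (@d_cut Pi (Rdiv B A) [::] [:: A] B d).
by apply: (@d_rdivL [:: A] A B [::] [::]); apply: d_ax.
Qed.

Lemma fle_ldiv A B C : fle B (Ldiv A C) <-> fle (Mul A B) C.
Proof. exact: iff_trans (derivable_ldiv _ _ _) (derivable_mul _ _ _ _). Qed.

Lemma fle_rdiv A B C : fle B (Rdiv C A) <-> fle (Mul B A) C.
Proof. exact: iff_trans (derivable_rdiv [:: B] A C) (derivable_mul B A [::] C). Qed.

Lemma fle_and A B C : fle C (And A B) <-> fle C A /\ fle C B.
Proof.
split=> [d|[]]; last exact: d_andR.
split; apply: (fle_trans d).
- by apply: (@d_andL1 A B [::] [::]); apply: d_ax.
- by apply: (@d_andL2 B A [::] [::]); apply: d_ax.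
Qed.

Lemma fle_zero A : fle Zero A.
Proof. exact: (@d_zeroL [::] [::]). Qed.

Lemma fle_one A : fle One A <-> derivable [::] A.
Proof.
split=> [|d]; last exact: (@d_oneL [::] [::]).
exact: derivable_fle d_oneR.
Qed.

Lemma derivable_iter_ldiv n Pi A B :
  derivable Pi (iter n (Ldiv A) B) <-> derivable (nseq n A ++ Pi) B.
Proof.
elim: n Pi => [//|n IHn] Pi; rewrite /= derivable_ldiv IHn.
suff -> : nseq n A ++ A :: Pi = A :: nseq n A ++ Pi by [].
by elim: (n) => //= m ->.
Qed.

Lemma derivable_iter_rdiv n Pi A B :
  derivable Pi (iter n (Rdiv^~ A) B) <-> derivable (Pi ++ nseq n A) B.
Proof.
elim: n Pi => [|n IHn] Pi; first by rewrite cats0.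
by rewrite /= derivable_rdiv IHn -catA.
Qed.

(** The omega-rule puts any common lower bound of the iterates below [ItLdiv A B]; the left rule
    with [n] blocks [[:: A]] puts it below each iterate. *)
Lemma fle_itldiv A B C : fle C (ItLdiv A B) <-> forall n, fle C (iter n (Ldiv A) B).
Proof.
split=> [d n|d]; last by apply: d_itldivR => n; apply/derivable_iter_ldiv; apply: d.
apply: (fle_trans d); apply/derivable_iter_ldiv.
have := @d_itldivL (nseq n [:: A]) A B [::] [::] B; rewrite /=.
have -> : flatten (nseq n [:: A]) = nseq n A by elim: (n) => //= m ->.
apply; last exact: d_ax.
by move=> i; rewrite size_nseq nth_nseq => ->; apply: d_ax.
Qed.

Lemma fle_itrdiv A B C : fle C (ItRdiv B A) <-> forall n, fle C (iter n (Rdiv^~ A) B).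
Proof.
split=> [d n|d]; last by apply: d_itrdivR => n; apply/derivable_iter_rdiv; apply: d.
apply: (fle_trans d); apply/derivable_iter_rdiv.
have := @d_itrdivL (nseq n [:: A]) A B [::] [::] B; rewrite /= cats0.
have -> : flatten (nseq n [:: A]) = nseq n A by elim: (n) => //= m ->.
apply; last exact: d_ax.
by move=> i; rewrite size_nseq nth_nseq => ->; apply: d_ax.
Qed.

(** * Theorems that are products *)

(* For the iterative divisions the premise with n = 0 already forces [slash B],
   and this implies all the others. *)
Fixpoint slash (A : formula) : Prop :=
  match A with
  | Var _ | Zero => False
  | One => True
  | Mul A B | And A B => slash A /\ slash B
  | Ldiv A B => derivable [::] (Ldiv A B) /\ (slash A -> slash B)
  | Rdiv B A => derivable [::] (Rdiv B A) /\ (slash A -> slash B)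
  | ItLdiv A B => derivable [::] (ItLdiv A B) /\ slash B
  | ItRdiv B A => derivable [::] (ItRdiv B A) /\ slash B
  end.

Lemma slash_derivable A : slash A -> derivable [::] A.
Proof.
elim: A => //=.
- by move=> _; apply: d_oneR.
- by move=> A IHA B IHB [/IHA dA /IHB dB]; apply: (@d_mulR [::] [::]).
- by move=> A _ B _ [].
- by move=> A _ B _ [].
- by move=> A IHA B IHB [/IHA dA /IHB dB]; apply: d_andR.
- by move=> A _ B _ [].
- by move=> A _ B _ [].
Qed.

Definition slash_all (Pi : seq formula) : Prop :=
  foldr (fun A P => slash A /\ P) True Pi.

Lemma slash_all_cat Pi D : slash_all (Pi ++ D) <-> slash_all Pi /\ slash_all D.
Proof. by elim: Pi => [|A Pi IH] /=; [|rewrite IH]; tauto. Qed.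

Lemma slash_all_derivable Pi B : slash_all Pi -> derivable Pi B -> derivable [::] B.
Proof.
elim: Pi => [//|A Pi IH] /= [sA sPi] d; apply: IH sPi _.
exact: (@d_cut [::] A [::] Pi B (slash_derivable sA) d).
Qed.

(** Induction on the derivation, where cut merely composes implications. The derivability clause at
    a right division rule comes from applying that rule and cutting away the slashed antecedent. *)
Lemma derivable_slash Pi B : derivable Pi B -> slash_all Pi -> slash B.
Proof.
elim=> {Pi B} [A|G D C||Pi A G D C _ IH1 _ IH2|Pi A B G D C _ IH1 _ IH2
  |Pi A B d IH|Pi A B G D C _ IH1 _ IH2|Pi A B d IH|A B G D C _ IH
  |Pi D A B _ IH1 _ IH2|A B G D C _ IH|A B G D C _ IH|Pi A B _ IH1 _ IH2
  |G D C _ IH|Pis A B G D C _ _ _ IH|Pi A B d IH|Pis A B G D C _ _ _ IH|Pi A B d IH];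
  rewrite ?slash_all_cat /= ?slash_all_cat /=.
all: try (move: IH); try (move: IH1 IH2); rewrite ?slash_all_cat /= ?slash_all_cat /=.
all: try tauto.
- move=> IH sPi; split; last by move=> sA; apply: IH.
  by apply: slash_all_derivable sPi _; apply: d_ldivR.
- move=> IH sPi; split; last by move=> sA; apply: IH.
  by apply: slash_all_derivable sPi _; apply: d_rdivR.
- move=> IH sPi; split; last exact: (IH 0).
  by apply: slash_all_derivable sPi _; apply: d_itldivR.
- move=> IH sPi; split; last by apply: (IH 0); rewrite cats0.
  by apply: slash_all_derivable sPi _; apply: d_itrdivR.
Qed.

Lemma fle_one_mul A B : fle One (Mul A B) -> fle One A /\ fle One B.
Proof.
move=> /fle_one d; have [sA sB] : slash (Mul A B) by apply: derivable_slash d _.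
by split; apply/fle_one; apply: slash_derivable.
Qed.

(** * Partial labels *)

(* [None] stands for a missing label and behaves as a top element absorbing
   products; no formula is above it. *)
Definition ole (a b : option formula) : Prop :=
  match b, a with
  | None, _ => True
  | Some B, Some A => fle A B
  | Some _, None => False
  end.

Definition omul (a b : option formula) : option formula :=
  if a is Some A then if b is Some B then Some (Mul A B) else None else None.

Lemma ole_refl a : ole a a.
Proof. by case: a => //= A; apply: fle_refl. Qed.

Lemma ole_trans b a c : ole a b -> ole b c -> ole a c.
Proof. by case: a b c => [A|] [B|] [C|] //=; apply: fle_trans. Qed.

Lemma ole_omul a a' b b' : ole a a' -> ole b b' -> ole (omul a b) (omul a' b').
Proof. by case: a a' b b' => [A|] [A'|] [B|] [B'|] //=; apply: fle_mul. Qed.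

Lemma ole_omulA a b c : ole (omul a (omul b c)) (omul (omul a b) c).
Proof. by case: a b c => [A|] [B|] [C|] //=; apply: fle_mulA. Qed.

Lemma ole_omulAV a b c : ole (omul (omul a b) c) (omul a (omul b c)).
Proof. by case: a b c => [A|] [B|] [C|] //=; apply: fle_mulAV. Qed.

Lemma ole_1omul a : ole a (omul (Some One) a).
Proof. by case: a => //= A; apply: fle_1mull. Qed.

Lemma ole_omul1 a : ole a (omul a (Some One)).
Proof. by case: a => //= A; apply: fle_1mulr. Qed.

Lemma omulN a : omul a None = None.
Proof. by case: a. Qed.

Lemma omul_isSome a b : omul a b -> a /\ b.
Proof. by case: a b => [A|] [B|]. Qed.

Lemma ole_isSome a b : ole a b -> b -> a.
Proof. by case: a b => [A|] [B|]. Qed.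

Lemma ole_Some_mul a b A B :
  ole a (Some A) -> ole b (Some B) -> ole (omul a b) (Some (Mul A B)).
Proof. exact: (@ole_omul a (Some A) b (Some B)). Qed.

Lemma ole_ldiv A B c : ole c (Some (Ldiv A B)) <-> ole (omul (Some A) c) (Some B).
Proof. by case: c => //= C; apply: fle_ldiv. Qed.

Lemma ole_rdiv A B c : ole c (Some (Rdiv B A)) <-> ole (omul c (Some A)) (Some B).
Proof. by case: c => //= C; apply: fle_rdiv. Qed.

(** * Labellings and their one-point extensions *)

Record labelling (n : nat) (l : nat -> nat -> option formula) : Prop := Labelling {
  lab_dom : forall u w, l u w -> (u < n) && (w < n);
  lab_diag : forall u, u < n -> l u u = Some One;
  lab_anti : forall u w, l u w -> l w u -> u = w;
  lab_tri : forall u v w, ole (l u w) (omul (l u v) (l v w)) }.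

(** [f u] labels the pair [(u, n)] and [g w] the pair [(n, w)]. *)
Definition extend (n : nat) (l : nat -> nat -> option formula)
    (f g : nat -> option formula) (u w : nat) : option formula :=
  if u == n then (if w == n then Some One else g w)
  else if w == n then f u else l u w.

(** The three inequalities are the instances of [lab_tri] with the new point last, first or in the
    middle; the final hypothesis excludes cycles. *)
Lemma extend_labelling n l (f g : nat -> option formula) : labelling n l ->
  (forall u, f u -> u < n) -> (forall w, g w -> w < n) ->
  (forall u v, ole (f u) (omul (l u v) (f v))) ->
  (forall v w, ole (g w) (omul (g v) (l v w))) ->
  (forall u w, ole (l u w) (omul (f u) (g w))) ->
  (forall v, f v -> g v -> False) ->
  labelling n.+1 (extend n l f g).
Proof.
move=> [ldom ldiag lanti ltri] fdom gdom fl lg fg disj; rewrite /extend; split.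
- move=> u w; case: eqP => [->|_]; case: eqP => [->|_]; rewrite ?ltnSn ?andbT //.
  + by move/gdom/ltnW.
  + by move/fdom/ltnW.
  + by move=> /ldom/andP[un wn]; rewrite !ltnS (ltnW un) (ltnW wn).
- move=> u; rewrite ltnS leq_eqVlt; case: eqP => //= _; exact: ldiag.
- move=> u w; case: eqP => [->|_]; case: eqP => [->|_] //.
  + by move=> gw /disj/(_ gw).
  + by move=> /disj.
  + exact: lanti.
- move=> u v w; case: (u =P n) => [_|_]; case: (w =P n) => [_|_];
    case: (v =P n) => [_|_] //; try exact: ole_1omul; try exact: ole_omul1.
  (* For the triple [(n, v, n)], [One] would have to imply the product of [g v] and [f v]; by [disj]
     one factor is missing. *)
  case Eg: (g v) => [B|//]; case Ef: (f v) => [A|//].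
  by case: (disj v); rewrite ?Ef ?Eg.
Qed.

Variant defect :=
| LdivDefect of nat & formula
| RdivDefect of nat & formula
| MulDefect of nat & nat & formula & formula.

(** Old points reach the new one only through [x], and the label is the product along that path, the
    largest that [lab_tri] allows. A product defect that fails its test adds an isolated point. *)
Definition new_in (l : nat -> nat -> option formula) (d : defect) : nat -> option formula :=
  match d with
  | LdivDefect _ _ => fun _ => None
  | RdivDefect x A => fun u => omul (l u x) (Some A)
  | MulDefect x z A B => fun u =>
      if `[< x != z /\ ole (l x z) (Some (Mul A B)) >] then omul (l u x) (Some A)
      else None
  end.

Definition new_out (l : nat -> nat -> option formula) (d : defect) : nat -> option formula :=
  match d with
  | LdivDefect z A => fun w => omul (Some A) (l z w)
  | RdivDefect _ _ => fun _ => None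
  | MulDefect x z A B => fun w =>
      if `[< x != z /\ ole (l x z) (Some (Mul A B)) >] then omul (Some B) (l z w)
      else None
  end.

Lemma extend_defect_labelling n l d :
  labelling n l -> labelling n.+1 (extend n l (new_in l d) (new_out l d)).
Proof.
move=> ll; have [ldom ldiag lanti ltri] := ll.
have inl x A u v : ole (omul (l u x) (Some A)) (omul (l u v) (omul (l v x) (Some A))).
  exact: ole_trans (ole_omul (ltri u v x) (ole_refl _)) (ole_omulAV _ _ _).
have outl z A v w : ole (omul (Some A) (l z w)) (omul (omul (Some A) (l z v)) (l v w)).
  exact: ole_trans (ole_omul (ole_refl _) (ltri z v w)) (ole_omulA _ _ _).
have indom x A u : omul (l u x) (Some A) -> u < n.
  by move=> /omul_isSome[/ldom/andP[]].
have outdom z A w : omul (Some A) (l z w) -> w < n.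
  by move=> /omul_isSome[_ /ldom/andP[]].
case: d => [z A|x A|x z A B]; rewrite /new_in /new_out.
- by apply: (extend_labelling ll) => // [w|u v]; [exact: outdom|rewrite omulN].
- by apply: (extend_labelling ll) => // [u|u v]; [exact: indom|rewrite omulN].
case: asboolP => [[xz lxz]|_]; last first.
  by apply: (extend_labelling ll) => // u v; rewrite omulN.
apply: (extend_labelling ll) => [u|w|u v|v w|u w|v].
- exact: indom.
- exact: outdom.
- exact: inl.
- exact: outl.
(* Go from [u] to [w] through [x] and [z], weaken the label of [(x, z)] to [Mul A B], and
   reassociate. *)
- apply: (ole_trans _ (ole_omulAV (omul (l u x) (Some A)) (Some B) (l z w))).
  apply: ole_trans (ltri u z w) _.
  apply: ole_trans (ole_omul (ltri u x z) (ole_refl _)) _.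
  apply: ole_trans (ole_omul (ole_omul (ole_refl _) lxz) (ole_refl _)) _.
  exact: ole_omul (ole_omulA _ (Some A) (Some B)) (ole_refl _).
(* A point [v] on both sides of the new one gives [z] before [v] before [x], but [x] is before
   [z]. *)
- move=> /omul_isSome[lvx _] /omul_isSome[_ lzv].
  case/eqP: xz; apply: lanti; first exact: (ole_isSome lxz).
  by apply: (ole_isSome (ltri z v x)); case: (l z v) (l v x) lzv lvx => [?|//] [].
Qed.

(** * The limit of all extensions *)

(** This injection into trees makes formulae, and hence defects, enumerable. *)
Fixpoint formula_tree (A : formula) : GenTree.tree nat :=
  match A with
  | Var n => GenTree.Leaf n
  | Zero => GenTree.Node 0 [::]
  | One => GenTree.Node 1 [::]
  | Mul A B => GenTree.Node 2 [:: formula_tree A; formula_tree B]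
  | Ldiv A B => GenTree.Node 3 [:: formula_tree A; formula_tree B]
  | Rdiv A B => GenTree.Node 4 [:: formula_tree A; formula_tree B]
  | And A B => GenTree.Node 5 [:: formula_tree A; formula_tree B]
  | ItLdiv A B => GenTree.Node 6 [:: formula_tree A; formula_tree B]
  | ItRdiv A B => GenTree.Node 7 [:: formula_tree A; formula_tree B]
  end.

Fixpoint tree_formula (t : GenTree.tree nat) : formula :=
  match t with
  | GenTree.Leaf n => Var n
  | GenTree.Node 1 _ => One
  | GenTree.Node 2 [:: a; b] => Mul (tree_formula a) (tree_formula b)
  | GenTree.Node 3 [:: a; b] => Ldiv (tree_formula a) (tree_formula b)
  | GenTree.Node 4 [:: a; b] => Rdiv (tree_formula a) (tree_formula b)
  | GenTree.Node 5 [:: a; b] => And (tree_formula a) (tree_formula b)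
  | GenTree.Node 6 [:: a; b] => ItLdiv (tree_formula a) (tree_formula b)
  | GenTree.Node 7 [:: a; b] => ItRdiv (tree_formula a) (tree_formula b)
  | GenTree.Node _ _ => Zero
  end.

Lemma formula_treeK : cancel formula_tree tree_formula.
Proof. by elim=> //= A -> B ->. Qed.

HB.instance Definition _ := Countable.copy formula (can_type formula_treeK).

Definition defect_code (d : defect) :
    nat * formula + nat * formula + nat * nat * (formula * formula) :=
  match d with
  | LdivDefect z A => inl (inl (z, A))
  | RdivDefect x A => inl (inr (x, A))
  | MulDefect x z A B => inr (x, z, (A, B))
  end.

Definition code_defect
    (c : nat * formula + nat * formula + nat * nat * (formula * formula)) : defect :=
  match c with
  | inl (inl (z, A)) => LdivDefect z A
  | inl (inr (x, A)) => RdivDefect x A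
  | inr (x, z, (A, B)) => MulDefect x z A B
  end.

Lemma defect_codeK : cancel defect_code code_defect.
Proof. by case. Qed.

(* The code of the defect is the 2-adic valuation, so every defect is
   scheduled infinitely often. *)
Definition schedule (n : nat) : defect :=
  if unpickle (logn 2 n) is Some c then code_defect c else LdivDefect 0 Zero.

Lemma schedule_unbounded d m : exists2 n, m < n & schedule n = d.
Proof.
(* The power of 2 fixes the valuation; the power of 3 pushes the number beyond [m]. *)
exists (2 ^ pickle (defect_code d) * 3 ^ m); last first.
  rewrite /schedule lognM ?expn_gt0 // !lognX logn_prime // [logn 2 3]logn_prime //.
  by rewrite muln1 muln0 addn0 pickleK defect_codeK.
apply: leq_trans (ltn_expl m (isT : 1 < 3)) _.
by rewrite leq_pmull // expn_gt0.
Qed.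

Fixpoint lab (n : nat) : nat -> nat -> option formula :=
  if n is m.+1 then
    extend m (lab m) (new_in (lab m) (schedule m)) (new_out (lab m) (schedule m))
  else fun _ _ => None.

Lemma lab_labelling n : labelling n (lab n).
Proof. by elim: n => [|n IHn] /=; [split|apply: extend_defect_labelling]. Qed.

Definition limlab (u w : nat) : option formula := lab (maxn u w).+1 u w.

(** Extensions never change labels between old points. *)
Lemma limlabE n u w : u < n -> w < n -> limlab u w = lab n u w.
Proof.
move=> un wn; have : maxn u w < n by rewrite gtn_max un.
rewrite /limlab; elim: n {un wn} => // n IHn.
rewrite ltnS leq_eqVlt => /predU1P[->//|mn]; rewrite IHn //= /extend.
by move: mn; rewrite gtn_max => /andP[un wn]; rewrite !ltn_eqF.
Qed.

Lemma limlab_diag u : limlab u u = Some One.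
Proof. by rewrite (@limlabE u.+1) // (lab_diag (lab_labelling _)). Qed.

Lemma limlab_tri u v w : ole (limlab u w) (omul (limlab u v) (limlab v w)).
Proof.
pose n := (u + v + w).+1.
have [un vn wn] : [/\ u < n, v < n & w < n].
  by rewrite /n !ltnS -addnA leq_addr addnCA leq_addr addnA leq_addl.
by rewrite !(@limlabE n) //; apply: lab_tri (lab_labelling n) _ _ _.
Qed.

Lemma limlab_in n u : u < n -> limlab u n = new_in (lab n) (schedule n) u.
Proof.
move=> un; rewrite (@limlabE n.+1) ?ltnSn ?ltnS ?(ltnW un) //.
by rewrite [lab n.+1]/(extend _ _ _ _) /extend (ltn_eqF un) eqxx.
Qed.

Lemma limlab_out n w : w < n -> limlab n w = new_out (lab n) (schedule n) w.
Proof.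
move=> wn; rewrite (@limlabE n.+1) ?ltnSn ?ltnS ?(ltnW wn) //.
by rewrite [lab n.+1]/(extend _ _ _ _) /extend (ltn_eqF wn) eqxx.
Qed.

(** The witness must be younger than [z] for its label towards [z] to be this exact product; hence
    each defect recurs infinitely often. *)
Lemma limlab_ldiv_witness y z A :
  exists2 x, ole (limlab x y) (Some A) & limlab x z = omul (Some A) (limlab y z).
Proof.
have [n] := schedule_unbounded (LdivDefect y A) (maxn y z).
rewrite gtn_max => /andP[yn zn] En; exists n; rewrite limlab_out // En.
  by rewrite /new_out (lab_diag (lab_labelling n)) //; apply: fle_mul1r.
by rewrite (@limlabE n).
Qed.

Lemma limlab_rdiv_witness x y A :
  exists2 z, ole (limlab y z) (Some A) & limlab x z = omul (limlab x y) (Some A).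
Proof.
have [n] := schedule_unbounded (RdivDefect y A) (maxn x y).
rewrite gtn_max => /andP[xn yn] En; exists n; rewrite limlab_in // En.
  by rewrite /new_in (lab_diag (lab_labelling n)) //; apply: fle_mul1l.
by rewrite (@limlabE n).
Qed.

Lemma limlab_mul_witness x z A B : ole (limlab x z) (Some (Mul A B)) ->
  exists2 y, ole (limlab x y) (Some A) & ole (limlab y z) (Some B).
Proof.
have [<-|xz] := eqVneq x z.
  by rewrite limlab_diag => /fle_one_mul[lA lB]; exists x; rewrite limlab_diag.
have [n] := schedule_unbounded (MulDefect x z A B) (maxn x z).
rewrite gtn_max => /andP[xn zn] En; rewrite (@limlabE n) // => lxz; exists n.
  rewrite limlab_in // En /new_in asboolT // (lab_diag (lab_labelling n)) //.
  exact: fle_mul1l.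
rewrite limlab_out // En /new_out asboolT // (lab_diag (lab_labelling n)) //.
exact: fle_mul1r.
Qed.

(** * The canonical model *)

Definition cval (A : formula) : set (nat * nat) :=
  [set uw | ole (limlab uw.1 uw.2) (Some A)].

Lemma cval_sub A B : cval A `<=` cval B <-> fle A B.
Proof.
split=> [sAB|lAB uw Auw]; last exact: (@ole_trans (Some A)).
(* The pair [(x, 0)] is labelled [Mul A One], so [A] occurs as a label up to equivalence. *)
have [x _ x0] := limlab_ldiv_witness 0 0 A.
have := sAB (x, 0); rewrite /cval /= x0 limlab_diag /= => /(_ (fle_mul1r A)).
exact: fle_trans (fle_1mulr A).
Qed.

Lemma cval_eq A B : fle A B -> fle B A -> cval A = cval B.
Proof. by move=> lAB lBA; apply/seteqP; split; apply/cval_sub. Qed.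

Lemma cval_mul A B : cval (Mul A B) = rcomp (cval A) (cval B).
Proof.
apply/seteqP; split=> -[x z]; first exact: limlab_mul_witness.
case=> y xy yz; exact: ole_trans (limlab_tri x y z) (ole_Some_mul xy yz).
Qed.

(** One inclusion is the triangle inequality. For the other, the witness [x] is generic: [(x, z)]
    lies in [cval B] exactly when residuation gives the claim. *)
Lemma cval_ldiv A B : cval (Ldiv A B) = rldiv (cval A) (cval B).
Proof.
apply/seteqP; split=> -[y z] /= => [/ole_ldiv yz x xy|H].
  apply: ole_trans (limlab_tri x y z) _; apply: ole_trans yz.
  exact: ole_omul xy (ole_refl _).
have [x xy xz] := limlab_ldiv_witness y z A.
by apply/ole_ldiv; rewrite -xz; apply: H.
Qed.

Lemma cval_rdiv B A : cval (Rdiv B A) = rrdiv (cval B) (cval A).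
Proof.
apply/seteqP; split=> -[x y] /= => [/ole_rdiv xy z yz|H].
  apply: ole_trans (limlab_tri x y z) _; apply: ole_trans xy.
  exact: ole_omul (ole_refl _) yz.
have [z yz xz] := limlab_rdiv_witness x y A.
by apply/ole_rdiv; rewrite -xz; apply: H.
Qed.

Lemma cval_and A B : cval (And A B) = cval A `&` cval B.
Proof.
apply/seteqP; split=> -[x y]; rewrite /cval /=; case: (limlab x y) => [C|] //=;
  by [move/fle_and|move=> H; apply/fle_and|case].
Qed.

Lemma cval_iter_ldiv n A B :
  cval (iter n (Ldiv A) B) = rldiv (rpow (cval A) n) (cval B).
Proof.
elim: n B => [|n IHn] B.
  apply/seteqP; split=> -[y z] H; last exact: (H y erefl).
  by move=> x xy; rewrite (xy : x = y).
(* [rpow] splits off its first factor, so the innermost division is peeled: (R o S) \ T = S \ (R \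
   T). *)
rewrite iterSr IHn cval_ldiv; apply/seteqP; split=> -[y z] H x.
  by case=> x' xx' x'y; apply: (H x').
by move=> xy t tx; apply: H; exists x.
Qed.

Lemma cval_iter_rdiv n A B :
  cval (iter n (Rdiv^~ A) B) = rrdiv (cval B) (rpow (cval A) n).
Proof.
elim: n => [|n IHn].
  apply/seteqP; split=> -[x y] H; last exact: (H y erefl).
  by move=> z yz; rewrite -(yz : y = z).
(* Here the outermost division is peeled: T / (R o S) = (T / S) / R. *)
rewrite iterS cval_rdiv IHn; apply/seteqP; split=> -[y z] H x.
  by case=> x' xx' x'y; apply: (H x').
by move=> xy t tx; apply: H; exists x.
Qed.

Lemma cval_itldiv A B : cval (ItLdiv A B) = rldiv (rstar (cval A)) (cval B).
Proof.
transitivity (\bigcap_n cval (iter n (Ldiv A) B)).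
  apply/seteqP; split=> -[y z]; rewrite /cval /bigcap /=; case: (limlab y z) => [C|] //=.
  - by move=> /fle_itldiv H n _; apply: H.
  - by move=> H; apply/fle_itldiv => n; apply: H.
  (* The term [n = 0] is [cval B], which contains no unlabelled pair. *)
  - by move=> /(_ 0 I).
apply/seteqP; split=> -[y z] H.
  by move=> x [n _ xy]; have := H n I; rewrite cval_iter_ldiv; apply.
by move=> n _; rewrite cval_iter_ldiv => x xy; apply: H; exists n.
Qed.

Lemma cval_itrdiv B A : cval (ItRdiv B A) = rrdiv (cval B) (rstar (cval A)).
Proof.
transitivity (\bigcap_n cval (iter n (Rdiv^~ A) B)).
  apply/seteqP; split=> -[y z]; rewrite /cval /bigcap /=; case: (limlab y z) => [C|] //=.
  - by move=> /fle_itrdiv H n _; apply: H.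
  - by move=> H; apply/fle_itrdiv => n; apply: H.
  - by move=> /(_ 0 I).
apply/seteqP; split=> -[y z] H.
  by move=> x [n _ xy]; have := H n I; rewrite cval_iter_rdiv; apply.
by move=> n _; rewrite cval_iter_rdiv => x xy; apply: H; exists n.
Qed.

(** With the values of formulae as the family, closure under each operation is an identity for
    [cval]. *)
Definition canonical_model : ns_square_model.
Proof.
apply: (@NSSquareModel nat (range cval) (cval One) (cval Zero) cval).
- exact: (inhabits 0).
- by move=> _ _ [A _ <-] [B _ <-]; exists (Mul A B) => //; apply: cval_mul.
- by move=> _ _ [A _ <-] [B _ <-]; exists (Ldiv A B) => //; apply: cval_ldiv.
- by move=> _ _ [B _ <-] [A _ <-]; exists (Rdiv B A) => //; apply: cval_rdiv.
- by move=> _ _ [A _ <-] [B _ <-]; exists (And A B) => //; apply: cval_and.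
- by exists One.
- move=> _ [A _ <-]; rewrite -cval_mul.
  by apply: cval_eq; [apply: fle_mul1l|apply: fle_1mull].
- move=> _ [A _ <-]; rewrite -cval_mul.
  by apply: cval_eq; [apply: fle_mul1r|apply: fle_1mulr].
- by exists Zero.
- by move=> _ [A _ <-]; apply/cval_sub; apply: fle_zero.
- by move=> A; exists A.
- exact: cval_mul.
- exact: cval_ldiv.
- exact: cval_rdiv.
- exact: cval_and.
- by [].
- by [].
- exact: cval_itldiv.
- exact: cval_itrdiv.
Defined.

Lemma foldl_cval A Pi :
  foldl (fun R C => rcomp R (cval C)) (cval A) Pi = cval (foldl Mul A Pi).
Proof. by elim: Pi A => //= B Pi IH A; rewrite -cval_mul IH. Qed.

Lemma derivable_foldl_mul A Pi B : fle (foldl Mul A Pi) B -> derivable (A :: Pi) B.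
Proof. by elim: Pi A => //= C Pi IH A /IH /derivable_mul. Qed.

Theorem theorem5p1 (Pi : seq formula) (B : formula) :
  (forall M : ns_square_model, sequent_true M Pi B) -> derivable Pi B.
Proof.
move=> /(_ canonical_model); case: Pi => [|A Pi] /=.
  move=> sB; apply/fle_one.
  (* The diagonal pair [(0, 0)] carries [One], so truth there reads One -> B. *)
  by have : ole (limlab 0 0) (Some B) := sB (0, 0) erefl; rewrite limlab_diag.
by rewrite foldl_cval => /cval_sub; apply: derivable_foldl_mul.
Qed.
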